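(* Let $\mathbf{V}_{\mathsf{hypo}}$ be the monoid variety generated by the hypoplactic monoid $\mathsf{hypo}$. Then $\mathbf{V}_{\mathsf{hypo}}$ has finite axiomatic rank.
   Context: Let $\mathcal{A} = \{1<2<3<\cdots\}$ be the ordered alphabet of positive integers. For a word $w$, $|w|_a$ is the number of occurrences of the letter $a$; the content of $w$ is the tuple $(|w|_a)_a$, and the support $\mathrm{supp}(w)$ is the set of letters occurring in $w$. A quasi-ribbon tableau is a finite grid of cells, aligned so that the leftmost cell in each row is below the rightmost cell of the previous row, filled with letters of $\mathcal{A}$ so that rows weakly increase from left to right and columns strictly increase from top to bottom. Krob--Thibon insertion of a letter $a$ into a quasi-ribbon tableau $T$: if no entry of $T$ is $\le a$, create a new cell $a$ and glue $T$ by its top-leftmost entry to the bottom of this cell; otherwise, let $x$ be the right-most and bottom-most entry of $T$ with $x \le a$, separate $T$ just after $x$, put a new entry $a$ to the right of $x$ and glue the remaining part of $T$ (below and to the right of $x$) onto the bottom of the new entry $a$. For $u \in \mathcal{A}^*$, $\mathrm{P}_{\mathsf{hypo}}(u)$ is the tableau obtained from the empty tableau by inserting the letters of $u$ from left to right. The hypoplactic congruence is: $u \equiv_{\mathsf{hypo}} v$ iff $\mathrm{P}_{\mathsf{hypo}}(u) = \mathrm{P}_{\mathsf{hypo}}(v)$. The hypoplactic monoid is $\mathsf{hypo} = \mathcal{A}^*/{\equiv_{\mathsf{hypo}}}$. Known equivalent description (Novelli): $u \equiv_{\mathsf{hypo}} v$ iff $u$ and $v$ have the same content and the same inversions, where,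 if $\mathrm{supp}(u) = \{a_1<\dots<a_k\}$, $u$ has an $a_{i+1}$-$a_i$ inversion ($1 \le i \le k-1$) iff $a_{i+1}a_i$ is a (scattered) subsequence of $u$. A (monoid) identity over an (infinite) alphabet of variables $X$ is a formal equality $u \approx v$ with $u,v \in X^*$; its rank is the number of distinct variables occurring in it. A monoid $M$ satisfies $u \approx v$ if $\psi(u) = \psi(v)$ for every monoid homomorphism $\psi: X^* \to M$. An identity $u \approx v$ is a consequence of a set $\Sigma$ of identities if there are words $u = w_1, \dots, w_k = v$ in $X^*$ and endomorphisms $\sigma_1,\dots,\sigma_{k-1}$ of $X^*$ such that, for $1 \le i < k$, $w_i = r_i\sigma_i(p_i)s_i$ and $w_{i+1} = r_i\sigma_i(q_i)s_i$ for some $p_i,q_i,r_i,s_i \in X^*$ with $p_i \approx q_i$ or $q_i \approx p_i$ in $\Sigma$. A monoid variety is a class of monoids closed under homomorphic images, submonoids and direct products; the variety generated by $M$ is the smallest one containing $M$, and its equational theory (the set of identities satisfied by all its members) is the set of identities satisfied by $M$. A set $\mathcal{B}$ of identities is a basis of a variety $\mathbf{V}$ if the equational theory of $\mathbf{V}$ consists of all consequences of $\mathcal{B}$. The axiomatic rank of $\mathbf{V}$ is the least natural number $r$ such that $\mathbf{V}$ admits a basis in which every identity has rank at most $r$; it is infinite if no such $r$ exists. *)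

(* Defs.v *)
From HB Require Import structures.
From Stdlib Require Import Relation_Operators.
From mathcomp Require Import all_boot all_order.
From mathcomp Require Import boolp classical_sets functions cardinality.

Set Implicit Arguments.
Unset Strict Implicit.
Unset Printing Implicit Defensive.

Import Order.TTheory.
Local Open Scope order_scope.
Local Open Scope quotient_scope.
Local Open Scope classical_set_scope.

(* The free monoid on X: words under concatenation. *)
Definition word (X : Type) := seq X.

HB.instance Definition _ (X : choiceType) := Choice.on (word X).
HB.instance Definition _ (X : choiceType) :=
  isMonoid.Build (word X) (@catA X) (@cat0s X) (@cats0 X).

Section QuasiRibbon.
Context {disp : Order.disp_t} {T : orderType disp}.
Implicit Types (a b : T) (r s : seq T) (t : seq (seq T)) (u v w : word T).

(* A quasi-ribbon tableau is the list of its rows, top to bottom.  As the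
   first cell of each row lies directly below the last cell of the previous
   row, these two cells are the only vertically adjacent ones, and so strictly
   increasing columns amount to the relation [above] on consecutive rows. *)
Definition above r s :=
  if (r, s) is (x :: r', y :: _) then last x r' < y else false.

Definition quasi_ribbon t :=
  all (fun r => (r != [::]) && sorted <=%O r) t && sorted above t.

Definition add_row r t := if r is [::] then t else r :: t.

(* Krob-Thibon insertion.  The recursion stops at the bottom-most row having
   an entry <= a, or at the top row if there is no such entry.  Rows being
   weakly increasing, the two filters split this row just after its last
   entry <= a; if no entry of the tableau is <= a, the first part is empty and
   [:: a] becomes a new top row. *)
Fixpoint insert a t : seq (seq T) :=
  if t is r :: t' then
    if has (has (fun x => x <= a)) t' then r :: insert a t'
    else rcons [seq x <- r | x <= a] a :: add_row [seq x <- r | a < x] t'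
  else [:: [:: a]].

Definition P_hypo w := foldl (fun t a => insert a t) [::] w.

Definition hypo_eq : rel (word T) := fun u v => P_hypo u == P_hypo v.

Let split_le a r : sorted <=%O r ->
  [seq x <- r | x <= a] ++ [seq x <- r | a < x] = r.
Proof.
elim: r => //= x r IH x_r.
case: leP => /= [_|a_x]; first by rewrite IH ?(path_sorted x_r).
have /allP r_x := order_path_min le_trans x_r.
have gt_a y : y \in r -> a < y by move=> /r_x; apply: lt_le_trans.
rewrite (eq_in_filter (a2 := pred0)) ?filter_pred0; last first.
  by move=> y /gt_a; rewrite leNgt => ->.
by congr (_ :: _); apply/all_filterP/allP.
Qed.

Let above_head a r s : sorted <=%O s -> has (fun x => x <= a) s ->
  above r (rcons [seq x <- s | x <= a] a) = above r s.
Proof.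
case: r s => [|x r] [|y s] //=.
move=> y_s s_a; have -> // : y <= a.
case/orP: s_a => // /hasP[z z_s z_a].
have /allP/(_ z z_s) y_z := order_path_min le_trans y_s.
exact: le_trans y_z z_a.
Qed.

Let above_gt a r s : ~~ has (fun x => x <= a) s -> s != [::] ->
  above (rcons r a) s.
Proof.
case: r s => [|x r] [|y s] //=; rewrite negb_or -ltNge => /andP[].
  by [].
by rewrite /above /= last_rcons => ->.
Qed.

Lemma insert_quasi_ribbon a t : quasi_ribbon t -> quasi_ribbon (insert a t).
Proof.
rewrite /quasi_ribbon; elim: t => [//|r t IH].
rewrite [X in X -> _]/= [insert a _]/= => /andP[/andP[r_ok t_ok] rt].
case: ifPn => [t_a|t_a].
  have := IH; rewrite t_ok (path_sorted rt) => /(_ isT) /andP[/= -> i_s].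
  rewrite /= r_ok /= {IH}; case: t t_a t_ok rt i_s => // s t s_a.
  move=> /= /andP[/andP[_ ss] _] /andP[rs _].
  case: ifPn => [_|t_a] /= i_s; first by rewrite rs i_s.
  rewrite i_s andbT above_head //.
  by move: s_a; rewrite /= (negPf t_a) orbF.
have /andP[r_n0 r_s] := r_ok.
have gt_t s : s \in t -> above (rcons [seq x <- r | x <= a] a) s.
  move=> s_t; apply: above_gt; first by apply: contra t_a => s_a; apply/hasP; exists s.
  by have /allP/(_ s s_t)/andP[] := t_ok.
have lo_ok : sorted <=%O (rcons [seq x <- r | x <= a] a).
  rewrite -cats1 (sorted_pairwise le_trans) pairwise_cat.
  rewrite -(sorted_pairwise le_trans) (sorted_filter le_trans) //= !andbT.
  by apply/allrelP=> x y; rewrite mem_filter inE => /andP[xa _] /eqP->.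
have hi_ok : sorted <=%O [seq x <- r | a < x] by rewrite (sorted_filter le_trans).
rewrite /= lo_ok /= -size_eq0 size_rcons /=.
have lr := split_le a r_s.
have := @above_gt a [seq x <- r | x <= a] [seq x <- r | a < x].
rewrite -all_predC all_filter.
under eq_all do rewrite /= ltNge implybb.
rewrite all_predT => /(_ isT).
case hiE: [seq x <- r | a < x] hi_ok lr => [|y hi] /= hi_ok lr.
  rewrite t_ok => _ /=; case: t t_ok rt gt_t {t_a IH} => // s t _ /=.
  by case/andP=> _ ->; rewrite andbT => /(_ s); rewrite mem_head; apply.
move=> /(_ isT) ab; rewrite hi_ok t_ok /= ab /=.
case: t t_ok rt gt_t {t_a IH} => // s t _ /= /andP[rs ->] _; rewrite andbT.
move: rs; rewrite -lr; case: s => [|z s]; first by case: (_ ++ _).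
by rewrite /above; case: [seq x <- r | x <= a] => [|x lo] /=; rewrite ?last_cat.
Qed.

Lemma P_hypo_quasi_ribbon w : quasi_ribbon (P_hypo w).
Proof.
by elim/last_ind: w => // w a IH; rewrite /P_hypo foldl_rcons insert_quasi_ribbon.
Qed.

(* Left multiplication by a letter is a well-defined operation on tableaux,
   because the mirror image of Krob-Thibon insertion commutes with it. *)
Let linsert := fix linsert a t : seq (seq T) :=
  if t is r :: t' then
    if has (fun x => a <= x) r then
      add_row [seq x <- r | x < a] ((a :: [seq x <- r | a <= x]) :: t')
    else r :: linsert a t'
  else [:: [:: a]].

Let add_row_n0 r t : r != [::] -> add_row r t = r :: t.
Proof. by case: r. Qed.

Let insert_add_row b r t : has (has (fun x => x <= b)) t ->
  insert b (add_row r t) = add_row r (insert b t).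
Proof. by case: r => //= x r ->. Qed.

Let has_linsert a b t : has (has (fun x => x <= b)) (linsert a t) =
  (a <= b) || has (has (fun x => x <= b)) t.
Proof.
elim: t => [|r t IH] /=; first by rewrite !orbF.
case: ifPn => r_a /=; last by rewrite IH orbCA.
have -> : has (fun x => x <= b) r =
    has (fun x => x <= b) [seq x <- r | x < a]
    || has (fun x => x <= b) [seq x <- r | a <= x].
  elim: r {r_a} => //= x r ->.
  by case: (ltP x a) => _ /=; [rewrite orbA | rewrite orbCA].
by case: [seq x <- r | x < a] => [|x lo] /=; case: (a <= b); rewrite /= ?orbT ?orbA.
Qed.

Let filter_none (p : pred T) r : ~~ has p r -> [seq x <- r | p x] = [::].
Proof. by rewrite has_filter negbK => /eqP. Qed.

Let filter_le_none b r : ~~ has (fun x => x <= b) r -> [seq x <- r | b < x] = r.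
Proof.
by rewrite -all_predC => /allP r_b; apply/all_filterP/allP => x /r_b /=; rewrite ltNge.
Qed.

Let insert_top b r t : ~~ has (has (fun x => x <= b)) t ->
  all (fun s => s != [::]) t ->
  insert b (add_row r t) =
  rcons [seq x <- r | x <= b] b :: add_row [seq x <- r | b < x] t.
Proof.
case: r => [|x r] t_b; last by rewrite /= (negPf t_b).
case: t t_b => //= s t; rewrite negb_or => /andP[s_b /negPf-> /andP[s_n0 _]].
by rewrite filter_none // filter_le_none // add_row_n0.
Qed.

Let linsert_insert a b t : all (fun r => r != [::]) t ->
  insert b (linsert a t) = linsert a (insert b t).
Proof.
elim: t => [|r t IH] /=.
  by move=> _; rewrite !orbF; case: leP => ab /=.
move=> /andP[r_n0 t_n0]; have {}IH := IH t_n0.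
have [r_a|r_a] := boolP (has (fun x => a <= x) r);
  have [t_b|t_b] := boolP (has (has (fun x => x <= b)) t).
- by rewrite insert_add_row /= ?t_b ?orbT //= r_a.
- have [ab|ba] := leP a b.
  + rewrite insert_add_row /= ?ab //= (negPf t_b) has_rcons ab /=.
    rewrite !filter_rcons ltNge ab /= -!filter_predI.
    congr (add_row _ ((a :: rcons _ b) :: add_row _ t)).
    * apply: eq_filter => x /=; case: (ltP x a) => //= xa.
      by rewrite (le_trans (ltW xa) ab).
    * by apply: eq_filter => x /=; rewrite andbC.
    * apply: eq_filter => x /=; case: (ltP b x) => //= bx.
      by rewrite (le_trans ab (ltW bx)).
  + have ge_gt x : a <= x -> b < x by apply: lt_le_trans.
    rewrite insert_top /= ?t_n0 //; last first.
      rewrite /= negb_or (leNgt a) ba /= t_b andbT -all_predC all_filter.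
      by apply/allP => x _; apply/implyP => /ge_gt; rewrite /= ltNge.
    rewrite has_rcons (leNgt a b) ba /=.
    have /negPf-> : ~~ has (fun x => a <= x) [seq x <- r | x <= b].
      by rewrite has_filter -filter_predI -has_filter -all_predC; apply/allP => x _;
         rewrite /= negb_and -!ltNge; case: (ltP x a) => //= /ge_gt.
    rewrite (@add_row_n0 [seq x <- r | b < x]); last first.
      by rewrite -has_filter; apply: (sub_has _ r_a) => x /ge_gt.
    have /= -> : has (fun x => a <= x) [seq x <- r | b < x].
      have /hasP[x x_r ax] := r_a; apply/hasP; exists x => //.
      by rewrite mem_filter x_r ge_gt.
    rewrite -!filter_predI.
    congr (rcons _ b :: add_row _ ((a :: _) :: t)).
    * by apply: eq_filter => x /=; case: (leP x b) => //= xb; rewrite (le_lt_trans xb ba).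
    * by apply: eq_filter => x /=; rewrite andbC.
    * by apply: eq_filter => x /=; case: (leP a x) => //= /ge_gt ->.
- by rewrite /= (negPf r_a) has_linsert t_b orbT IH.
- rewrite /= has_linsert (negPf t_b) orbF.
  have lt_a x : x \in r -> x < a.
    by move: r_a; rewrite -all_predC => /allP /= r_a /r_a; rewrite ltNge.
  have [ab|ba] := leP a b.
  + have rE : [seq x <- r | x <= b] = r.
      by apply/all_filterP/allP => x /lt_a xa; rewrite (le_trans (ltW xa) ab).
    rewrite rE has_rcons ab /= !filter_rcons ltNge ab /=.
    rewrite (all_filterP (introT allP lt_a)) add_row_n0 // filter_none //.
    rewrite (@filter_none (fun x => b < x)); last first.
      rewrite -all_predC; apply/allP => x /lt_a xa /=.
      by rewrite -leNgt (le_trans (ltW xa) ab).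
    congr (r :: _); case: t t_n0 t_b {IH} => [|s t] /=.
      by rewrite ab ltNge ab.
    move=> /andP[s_n0 _]; rewrite negb_or => /andP[s_b /negPf t_b].
    have ge_a x : x \in s -> a <= x.
      move=> x_s; apply/ltW/(le_lt_trans ab); rewrite ltNge.
      by apply: contra s_b => x_b; apply/hasP; exists x.
    have /= -> : has (fun x => a <= x) s.
      by case: s s_n0 ge_a {s_b} => //= x s _ ->; rewrite // mem_head.
    rewrite filter_none /=; last first.
      by rewrite -all_predC; apply/allP => x /ge_a; rewrite /= -leNgt.
    have /all_filterP /= -> : all (fun x => a <= x) s by apply/allP.
    rewrite t_b ab (ltNge b) ab /=.
    by rewrite filter_none // filter_le_none // add_row_n0.
  + have lo : ~~ has (fun x => a <= x) (rcons [seq x <- r | x <= b] b).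
      rewrite has_rcons leNgt ba /= -all_predC all_filter.
      by apply/allP => x /lt_a xa; rewrite /= -ltNge xa implybT.
    rewrite (negPf lo); congr (_ :: _).
    have : ~~ has (fun x => a <= x) [seq x <- r | b < x].
      by rewrite -all_predC all_filter; apply/allP => x /lt_a xa; rewrite /= -ltNge xa implybT.
    by case: [seq x <- r | b < x] => //= x hi /negPf->.
Qed.

Lemma hypo_eq_refl : reflexive hypo_eq.
Proof. by move=> u; apply: eqxx. Qed.

Lemma hypo_eq_sym : symmetric hypo_eq.
Proof. by move=> u v; apply: eq_sym. Qed.

Lemma hypo_eq_trans : transitive hypo_eq.
Proof. by move=> v u w /eqP uv /eqP vw; apply/eqP/(etrans uv). Qed.

Let P_hypo_cons a w : P_hypo (a :: w) = linsert a (P_hypo w).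
Proof.
elim/last_ind: w => // w b IH.
rewrite -rcons_cons /P_hypo !foldl_rcons -/(P_hypo _) -/(P_hypo (a :: w)) IH.
rewrite linsert_insert //; have /andP[/allP w_ok _] := P_hypo_quasi_ribbon w.
by apply/allP => r /w_ok/andP[].
Qed.

Lemma hypo_eq_cat u u' v v' :
  hypo_eq u u' -> hypo_eq v v' -> hypo_eq (u ++ v) (u' ++ v').
Proof.
move=> /eqP uu' /eqP vv'; apply/eqP.
have -> : P_hypo (u ++ v) = P_hypo (u ++ v').
  by elim: u {uu'} => //= a u IH; rewrite !P_hypo_cons IH.
by move: uu'; rewrite /P_hypo !foldl_cat => ->.
Qed.

Canonical hypo_eq_equiv := EquivRel hypo_eq hypo_eq_refl hypo_eq_sym hypo_eq_trans.
End QuasiRibbon.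

Definition letter := {n : nat | (0 < n)%N}.
HB.instance Definition _ := Countable.on letter.
HB.instance Definition _ := SubType.on letter.
HB.instance Definition _ :=
  [SubChoice_isSubOrder of letter by <: with Order.Disp tt tt].

Definition hypo := {eq_quot (@hypo_eq _ letter)}.
HB.instance Definition _ := Choice.on hypo.
HB.instance Definition _ := EqQuotient.on hypo.

Definition hypo_one : hypo := \pi_hypo ([::] : word letter).
Definition hypo_mul : hypo -> hypo -> hypo :=
  lift_op2 hypo (fun u v : word letter => u ++ v).

Lemma pi_hypo_mul :
  {morph \pi_hypo : u v / (u ++ v : word letter) >-> hypo_mul u v}.
Proof.
move=> u v; unlock hypo_mul; apply/eqmodP/hypo_eq_cat.
all: by apply/eqmodP; rewrite /= reprK.
Qed.

Lemma hypo_mulA : associative hypo_mul.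
Proof.
elim/quotW=> u; elim/quotW=> v; elim/quotW=> w.
by rewrite -!pi_hypo_mul catA.
Qed.

Lemma hypo_mul1g : left_id hypo_one hypo_mul.
Proof. by elim/quotW=> u; rewrite -pi_hypo_mul. Qed.

Lemma hypo_mulg1 : right_id hypo_one hypo_mul.
Proof. by elim/quotW=> u; rewrite -pi_hypo_mul cats0. Qed.

HB.instance Definition _ := isMonoid.Build hypo hypo_mulA hypo_mul1g hypo_mulg1.

Local Open Scope group_scope.

Definition direct_product (I : Type) (M : I -> monoidType) := forall i, M i.

Section DirectProduct.
Context (I : Type) (M : I -> monoidType).
Implicit Types f g h : direct_product M.

HB.instance Definition _ := Choice.on (direct_product M).

Let one : direct_product M := fun i => 1.
Let mul f g : direct_product M := fun i => f i * g i.

Let mulA : associative mul.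
Proof. by move=> f g h; apply: functional_extensionality_dep => i; apply: mulgA. Qed.

Let mul1 : left_id one mul.
Proof. by move=> f; apply: functional_extensionality_dep => i; apply: mul1g. Qed.

Let mulr1 : right_id one mul.
Proof. by move=> f; apply: functional_extensionality_dep => i; apply: mulg1. Qed.

HB.instance Definition _ := isMonoid.Build (direct_product M) mulA mul1 mulr1.

End DirectProduct.

(* Classes of monoids are predicates on monoidType, which is too large for the
   universe of [set]. *)
Record variety (V : monoidType -> Prop) : Prop := Variety {
  variety_image : forall (M N : monoidType) (f : UMagmaMorphism.type M N),
    (forall y, exists x, f x = y) -> V M -> V N;
  variety_submonoid : forall (M : monoidType) (P : pred M) (N : subMonoidType P),
    V M -> V N;
  variety_product : forall (I : Type) (M : I -> monoidType),
    (forall i, V (M i)) -> V (direct_product M)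
}.

Definition generated_variety (M : monoidType) : monoidType -> Prop :=
  fun N => forall V : monoidType -> Prop, variety V -> V M -> V N.

Definition V_hypo := generated_variety hypo.

Section Identities.
Context (X : choiceType).

(* The pair (u, v) stands for the formal equality of u and v. *)
Definition identity : Type := word X * word X.
Implicit Types (e : identity) (B : set identity) (V : monoidType -> Prop).

Definition rank e : nat := size (undup (e.1 ++ e.2 : word X)).

Definition satisfies (M : monoidType) e :=
  forall psi : UMagmaMorphism.type (word X) M, psi e.1 = psi e.2.

Definition equational_theory V : set identity :=
  [set e | forall M, V M -> satisfies M e].

Definition deduction_step B (w w' : word X) : Prop :=
  exists (p q r s : word X) (sigma : UMagmaMorphism.type (word X) (word X)),
    [/\ B (p, q) \/ B (q, p), w = r * sigma p * s & w' = r * sigma q * s].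

Definition consequences B : set identity :=
  [set e | clos_refl_trans_1n _ (deduction_step B) e.1 e.2].

Definition basis V B := equational_theory V = consequences B.

Definition has_basis_of_rank_le V (r : nat) :=
  exists2 B, basis V B & forall e, B e -> (rank e <= r)%N.

Definition is_axiomatic_rank V (r : nat) :=
  has_basis_of_rank_le V r /\
  forall r', has_basis_of_rank_le V r' -> (r <= r')%N.

Definition finite_axiomatic_rank V := exists r, is_axiomatic_rank V r.

End Identities.

(* Main.v *)
(* An identity u = v holds in hypo iff u and v have the same content and the
   same subsequences xy with x != y.  Sufficiency: restricting a word to an
   interval of letters restricts its tableau, and a word is sorted iff its
   tableau has at most one row; so the rows of P(u) are read off the maximal
   intervals to which u restricts to a sorted word.  Necessity: substitute
   letters 1 and 2.

   Two such words are connected by swaps p x y q -> p y x q where both xy and yx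
   remain subsequences after the swap, i.e. (x in p or y in q) and (y in p or
   x in q): carry the first letter of v to the front of u, and iterate.  Each
   such swap is an instance of an identity in the variables x, y and at most two
   others standing for the factors between the occurrences involved, e.g.
   xzytxy = xzytyx.  Hence the identities of rank at most 4 form a basis. *)
Require Import Defs.
From HB Require Import structures.
From Stdlib Require Import Relation_Operators Operators_Properties.
From mathcomp Require Import all_boot all_order.
From mathcomp Require Import finmap.
From mathcomp Require Import boolp classical_sets functions cardinality.

Set Implicit Arguments.
Unset Strict Implicit.
Unset Printing Implicit Defensive.

Import Order.TTheory.
Local Open Scope order_scope.

(** * Restriction of quasi-ribbon tableaux to convex sets of letters *)

Section Tableaux.
Context {disp : Order.disp_t} {T : orderType disp}.
Implicit Types (a : T) (p : pred T) (r s : seq T) (t : seq (seq T)) (u v w : word T).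

Lemma quasi_ribbon_cons r t : quasi_ribbon (r :: t) ->
  [/\ r != [::], sorted <=%O r, quasi_ribbon t & allrel <%O r (flatten t)].
Proof.
rewrite /quasi_ribbon [X in X -> _]/= => /andP[/andP[/andP[r_n0 r_s] t_ok] rt].
split=> //; first by rewrite t_ok (path_sorted rt).
elim: t r r_n0 r_s t_ok rt => [|s t IH] r r_n0 r_s /=; first by rewrite allrel0r.
move=> /andP[/andP[s_n0 s_s] t_ok] /andP[rs st].
have st_lt := IH s s_n0 s_s t_ok st.
case: s s_n0 s_s rs st st_lt {IH} => // y s _ s_s.
case: r r_n0 r_s => // x r _ r_s /= xy _ /= ylt.
have r_y z : z \in x :: r -> z < y.
  move=> z_r; apply: le_lt_trans xy.
  move: r_s; rewrite /= -[path _ _ _]/(sorted <=%O (x :: r)) lastI.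
  rewrite (sorted_pairwise le_trans) pairwise_rcons => /andP[/allP le_last _].
  by move: z_r; rewrite lastI mem_rcons inE => /predU1P[->//|/le_last].
apply/allrelP => z w /r_y zy; rewrite inE mem_cat => /predU1P[->//|/orP[w_s|w_t]].
  have /allP/(_ w w_s) yw := order_path_min le_trans s_s.
  exact: lt_le_trans yw.
by apply: lt_trans zy _; move: ylt; rewrite allrel_consl => /andP[/allP/(_ w w_t)].
Qed.

Lemma quasi_ribbon_neq0 t : quasi_ribbon t -> all (fun r => r != [::]) t.
Proof. by case/andP=> /allP t_ok _; apply/allP => r /t_ok/andP[]. Qed.

Lemma insert_add_row a r t : has (has (fun x => x <= a)) t ->
  insert a (add_row r t) = add_row r (insert a t).
Proof. by case: r => //= x r ->. Qed.

Lemma insert_top a r t : ~~ has (has (fun x => x <= a)) t ->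
  all (fun s => s != [::]) t ->
  insert a (add_row r t) =
  rcons [seq x <- r | x <= a] a :: add_row [seq x <- r | a < x] t.
Proof.
case: r => [|x r] t_a; last by rewrite /= (negPf t_a).
case: t t_a => //= s t; rewrite negb_or => /andP[/hasPn s_a /negPf-> /andP[s_n0 _]].
rewrite (eq_in_filter (a2 := pred0)) ?filter_pred0; last first.
  by move=> x /s_a /= /negPf.
rewrite (eq_in_filter (a2 := predT)) ?filter_predT; last first.
  by move=> x /s_a /=; rewrite ltNge.
by case: s s_n0 {s_a}.
Qed.

Definition convex p := forall x y z, p x -> p z -> x <= y -> y <= z -> p y.

(** Emptied rows are dropped, since a quasi-ribbon tableau has none. *)
Definition restrict p t := foldr (fun r => add_row (filter p r)) [::] t.

Lemma restrict_add_row p r t : restrict p (add_row r t) = add_row (filter p r) (restrict p t).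
Proof. by case: r. Qed.

Lemma restrict_neq0 p t : all (fun r => r != [::]) (restrict p t).
Proof. by elim: t => //= r t; case: (filter p r). Qed.

Lemma flatten_add_row r t : flatten (add_row r t) = r ++ flatten t.
Proof. by case: r. Qed.

Lemma flatten_restrict p t : flatten (restrict p t) = filter p (flatten t).
Proof. by elim: t => //= r t IH; rewrite flatten_add_row filter_cat IH. Qed.

Lemma has_flatten p t : has (has p) t = has p (flatten t).
Proof. by elim: t => //= r t ->; rewrite has_cat. Qed.

(** An insertion cuts one row between the letters on either side of [a]. If [p a] fails, convexity
    leaves letters of [p] on one side of the cut only, so the cut disappears in the restriction. *)
Lemma restrict_insert p a t : convex p -> quasi_ribbon t ->
  restrict p (insert a t) = if p a then insert a (restrict p t) else restrict p t.
Proof.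
move=> p_cvx; elim: t => [|r t IH] t_ok; first by rewrite /=; case: ifP.
have [r_n0 r_s /IH{}IH /allrelP rt] := quasi_ribbon_cons t_ok.
rewrite [insert a _]/=; case: ifPn => [t_a|t_a].
  rewrite /= IH; case: ifP => // pa.
  have [pt_a|] := boolP (has (has (fun x => x <= a)) (restrict p t)).
    by rewrite insert_add_row.
  (* If [t] has an entry [z <= a] but its restriction has none, then [p] erases [r]: a kept entry of
     [r] lies below [z], so convexity would also keep [z]. *)
  move: t_a; rewrite !has_flatten flatten_restrict => /hasP[z z_t z_a] /hasPn pt_a.
  rewrite (_ : filter p r = [::]) //; apply/eqP; rewrite -[_ == _]negbK -has_filter.
  apply/hasPn => x x_r.
  apply/negP => px; have xz := ltW (rt _ _ x_r z_t).
  have /= := pt_a z; rewrite mem_filter z_t (p_cvx x z a) // z_a.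
  by move=> /(_ isT).
have pt_a : ~~ has (has (fun x => x <= a)) (restrict p t).
  move: t_a; rewrite !has_flatten flatten_restrict -!all_predC all_filter.
  by apply: sub_all => x /= ->; rewrite implybT.
rewrite /= restrict_add_row filter_rcons -!filter_predI.
case: ifPn => pa.
  rewrite insert_top ?restrict_neq0 // -!filter_predI.
  case E: (rcons _ a) => [|x s]; first by case: (filter _ _) E.
  rewrite /= -E; congr (rcons _ _ :: add_row _ _); apply: eq_filter => y /=; exact: andbC.
have [/hasP[x x_r /= /andP[px xa]]|] := boolP (has (predI p (fun x => x <= a)) r).
  rewrite [X in add_row _ (add_row X _)](eq_filter (a2 := pred0)) ?filter_pred0 /=; last first.
    move=> y /=; apply/negbTE; rewrite negb_and -implybE; apply/implyP => py.
    by apply: contra pa => /ltW ay; apply: (p_cvx x a y).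
  congr add_row; apply: eq_filter => y /=; case: leP; rewrite ?andbT // andbF => ay.
  by apply/esym/negbTE; apply: contra pa => py; apply: (p_cvx x a y) => //; apply: ltW.
move=> /hasPn r_a.
rewrite (eq_in_filter (a2 := pred0)) ?filter_pred0 /=; last by move=> x /r_a /negPf.
congr add_row; apply: eq_in_filter => y /r_a /=.
by rewrite ltNge; case: (p y); case: (y <= a).
Qed.

Lemma P_hypo_rcons w a : P_hypo (rcons w a) = insert a (P_hypo w).
Proof. by rewrite /P_hypo foldl_rcons. Qed.

Lemma restrict_P_hypo p w : convex p -> restrict p (P_hypo w) = P_hypo (filter p w).
Proof.
move=> p_cvx; elim/last_ind: w => // w a IH.
rewrite P_hypo_rcons restrict_insert ?P_hypo_quasi_ribbon // filter_rcons IH.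
by case: ifP => // _; rewrite P_hypo_rcons.
Qed.

Lemma P_hypo_sorted w : sorted <=%O w -> P_hypo w = add_row w [::].
Proof.
elim/last_ind: w => // w a IH wa_s; rewrite P_hypo_rcons.
move: wa_s; rewrite (sorted_pairwise le_trans) pairwise_rcons.
rewrite -(sorted_pairwise le_trans) => /andP[/allP w_a /IH->].
rewrite insert_top // (eq_in_filter (a2 := predT)) ?filter_predT //.
rewrite (eq_in_filter (a2 := pred0)) ?filter_pred0 //; first by case: w {w_a IH}.
by move=> x /w_a; rewrite ltNge => ->.
Qed.

Lemma size_add_row r t : size (add_row r t) = ((r != [::]) + size t)%N.
Proof. by case: r. Qed.

Lemma size_insert a t : (size t <= size (insert a t))%N.
Proof.
elim: t => //= r t IH; case: ifP => //= _.
by rewrite size_add_row ltnS leq_addl.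
Qed.

(** Insertion never reduces the number of rows, so induction applies to the prefix; a last letter
    smaller than an earlier one would split the single row. *)
Lemma sorted_size_P_hypo w : (size (P_hypo w) <= 1)%N -> sorted <=%O w.
Proof.
elim/last_ind: w => // w a IH; rewrite P_hypo_rcons => wa_1.
have w_s := IH (leq_trans (size_insert a _) wa_1).
rewrite (sorted_pairwise le_trans) pairwise_rcons -(sorted_pairwise le_trans) w_s.
rewrite andbT; apply: contraLR wa_1 => w_a.
rewrite P_hypo_sorted // insert_top //= size_add_row -has_filter -ltnNge.
move: w_a; rewrite -has_predC => /hasP[x x_w /=]; rewrite -ltNge => ax.
by rewrite (_ : has _ w) //; apply/hasP; exists x.
Qed.

Lemma hypo_eq_sorted u v : hypo_eq u v -> sorted <=%O u -> v = u.
Proof.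
move=> /eqP uv u_s.
have v_s : sorted <=%O v.
  by apply: sorted_size_P_hypo; rewrite -uv P_hypo_sorted // size_add_row; case: (u != _).
by move: uv; rewrite !P_hypo_sorted //; case: u u_s; case: v v_s => //= x v _ y u _ [-> ->].
Qed.
End Tableaux.

(** * Words with the same content and the same subsequences of length two *)

Section SamePairs.
Context {T : choiceType}.
Implicit Types (u v w : word T) (p : pred T) (r : rel T).

(* The values [pairwise r u] for all [r] determine which words of length 2 are
   subsequences of u, and conversely; in this form, stability under filtering
   and substitution is immediate. *)
Definition same_pairs u v := perm_eq u v /\ forall r, pairwise r u = pairwise r v.

Lemma pairwise_filterE r p u :
  pairwise r (filter p u) = pairwise (fun x y => [&& p x & p y] ==> r x y) u.
Proof.
elim: u => //= x u <-; case px: (p x) => /=.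
  by rewrite all_filter; congr andb; apply: eq_all => y /=; case: (p y).
by rewrite [X in _ = X && _](_ : _ = true) //; apply/allP.
Qed.

Lemma same_pairs_filter p u v : same_pairs u v -> same_pairs (filter p u) (filter p v).
Proof.
by move=> [uv ruv]; split=> [|r]; [exact: perm_filter | rewrite !pairwise_filterE].
Qed.

Lemma pairwise_flatten r (ss : seq (seq T)) :
  pairwise r (flatten ss) = all (pairwise r) ss && pairwise (allrel r) ss.
Proof.
elim: ss => //= s ss IH; rewrite pairwise_cat {}IH.
have -> : allrel r s (flatten ss) = all (allrel r s) ss.
  by elim: ss => [|s' ss IH] /=; rewrite ?allrel0r // allrel_catr IH.
by case: (all (allrel r s) ss); case: (pairwise r s); rewrite ?andbF.
Qed.
End SamePairs.

(** A relation holds pairwise in a concatenation iff it does inside each block, which depends on the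
    content alone, and between blocks, which is a pairwise condition on the original word. *)
Lemma same_pairs_flatten_map (S T : choiceType) (f : S -> word T) (u v : word S) :
  same_pairs u v -> same_pairs (flatten (map f u)) (flatten (map f v)).
Proof.
move=> [uv ruv]; split=> [|r]; first by rewrite perm_flatten ?perm_map.
by rewrite !pairwise_flatten !pairwise_map (ruv (relpre f (allrel r))) (perm_all _ (perm_map f uv)).
Qed.

(** * Words with the same pairs have the same tableau *)

Section Novelli.
Context {disp : Order.disp_t} {T : orderType disp}.
Implicit Types (p : pred T) (r : seq T) (u v w : word T) (t : seq (seq T)).

Lemma restrict_cons p r t : restrict p (r :: t) = add_row (filter p r) (restrict p t).
Proof. by []. Qed.

Lemma restrict_none p t : ~~ has p (flatten t) -> restrict p t = [::].
Proof.
elim: t => //= r t IH; rewrite has_cat negb_or => /andP[r_p /IH->].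
by move: r_p; rewrite has_filter negbK => /eqP->.
Qed.

Lemma restrict_all p t : all (fun r => r != [::]) t -> all p (flatten t) -> restrict p t = t.
Proof.
elim: t => //= r t IH /andP[r_n0 t_n0]; rewrite all_cat => /andP[/all_filterP-> t_p].
by rewrite IH //; case: r r_n0.
Qed.

Lemma P_hypo_eq0 u : P_hypo u = [::] -> u = [::].
Proof.
move=> u0; have u_s : sorted <=%O u by apply: sorted_size_P_hypo; rewrite u0.
by move: u0; rewrite P_hypo_sorted //; case: u {u_s}.
Qed.

Lemma convex_le (y : T) : convex (fun x => x <= y).
Proof. by move=> a b c _ cy _ bc; apply: le_trans cy. Qed.

Lemma convex_gt (y : T) : convex (fun x => y < x).
Proof. by move=> a b c ya _ ab _; apply: lt_le_trans ab. Qed.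

(** Both halves restrict the tableau to a convex set. Letters [<= y] give the first row alone, and a
    word with a one-row tableau is sorted, hence equal to that row; letters [> y] give the other
    rows. *)
Lemma P_hypo_top_row u x r t (y := last x r) : P_hypo u = (x :: r) :: t ->
  [seq z <- u | z <= y] = x :: r /\ P_hypo [seq z <- u | y < z] = t.
Proof.
move=> uE; have := P_hypo_quasi_ribbon u; rewrite uE => /quasi_ribbon_cons[_ r_s].
move=> /quasi_ribbon_neq0 t_n0 /allrelP rt.
have le_y z : z \in x :: r -> z <= y.
  move: r_s; rewrite lastI (sorted_pairwise le_trans) pairwise_rcons => /andP[/allP r_y _].
  by rewrite mem_rcons inE => /predU1P[->//|/r_y].
have gt_y z : z \in flatten t -> y < z by apply: rt; rewrite mem_last.
split; last first.
  rewrite -restrict_P_hypo; last exact: convex_gt.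
  rewrite uE restrict_cons.
  rewrite restrict_all //; last by apply/allP.
  rewrite (eq_in_filter (a2 := pred0)) ?filter_pred0 // => z /le_y.
  by rewrite ltNge => ->.
have Pu : P_hypo [seq z <- u | z <= y] = [:: x :: r].
  rewrite -restrict_P_hypo; last exact: convex_le.
  rewrite uE restrict_cons.
  rewrite restrict_none; last by apply/hasPn => z /gt_y /=; rewrite ltNge.
  by rewrite (eq_in_filter (a2 := predT)) ?filter_predT // => z /le_y ->.
have : sorted <=%O [seq z <- u | z <= y] by apply: sorted_size_P_hypo; rewrite Pu.
by move: Pu => /[swap] /P_hypo_sorted ->; case: (filter _ _) => // ? ? [-> ->].
Qed.

(* With [y] the last entry of the first row of P(u), this row is the part of
   [u] below [y], which is thus sorted; so it is also the part of [v] below [y],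
   and it is contained in the first row of P(v). *)
Lemma top_row_subseq u v r r' t t' : same_pairs u v ->
  P_hypo u = r :: t -> P_hypo v = r' :: t' -> subseq r r'.
Proof.
move=> uv uE vE; have := P_hypo_quasi_ribbon u; rewrite uE => /quasi_ribbon_cons[r_n0 r_s _ _].
have := P_hypo_quasi_ribbon v; rewrite vE => /quasi_ribbon_cons[r'_n0 _ _ /allrelP r't'].
case: r r_n0 r_s uE => // x r _ r_s /P_hypo_top_row; set y := last x r => -[u_r _].
have v_r : [seq z <- v | z <= y] = x :: r.
  have [uv_y ruv_y] := same_pairs_filter (fun z => z <= y) uv.
  rewrite -u_r; apply: (sorted_eq le_trans le_anti); last by rewrite perm_sym.
    by rewrite (sorted_pairwise le_trans) -ruv_y -(sorted_pairwise le_trans) u_r.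
  by rewrite u_r.
have := restrict_P_hypo v (@convex_le y).
rewrite v_r (P_hypo_sorted r_s) vE /=; case E: (filter _ r') => [|a s]; last first.
  by move=> [<- <- _]; rewrite -E filter_subseq.
(* If no entry of [r'] were at most [y], then [y] would occur in [t'], so it would exceed every
   entry of [r'], a contradiction. *)
move=> /= rE; have : y \in flatten (restrict (fun z => z <= y) t').
  by rewrite rE /= cats0 mem_last.
rewrite flatten_restrict mem_filter => /andP[_ y_t'].
case: r' r'_n0 r't' E {vE} => // b r' _ r't' /=.
by rewrite ltW // r't' // mem_head.
Qed.

(** The first rows are subsequences of each other, hence equal. The other rows form the tableaux of
    the letters above the last entry of this row; these words are shorter and again have the same
    pairs. *)
Lemma hypo_eq_same_pairs u v : same_pairs u v -> hypo_eq u v.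
Proof.
have [n] := ubnP (size u); elim: n u v => // n IH u v /ltnSE-u_n uv.
have vu : same_pairs v u by case: uv => uv ruv; split=> [|r]; rewrite ?ruv // perm_sym.
rewrite /hypo_eq; case uE: (P_hypo u) => [|r t].
  have u0 := P_hypo_eq0 uE; case: uv => /perm_size.
  by rewrite u0; case: (v).
case vE: (P_hypo v) => [|r' t'].
  have v0 := P_hypo_eq0 vE; case: uv => /perm_size /eqP.
  by rewrite v0 size_eq0 => /eqP u0; rewrite u0 in uE.
have rr' := top_row_subseq uv uE vE; have r'r := top_row_subseq vu vE uE.
have {rr' r'r} rr' : r' = r.
  apply/eqP; have [_ <-] := size_subseq_leqif r'r.
  by rewrite eqn_leq !size_subseq.
move: vE; rewrite {}rr' => vE; apply/eqP; congr (_ :: _).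
have := P_hypo_quasi_ribbon u; rewrite uE => /quasi_ribbon_cons[r_n0 _ _ _].
case: r r_n0 uE vE => // x r _ /P_hypo_top_row[u_r <-] /P_hypo_top_row[_ <-].
apply/eqP/IH; last exact: same_pairs_filter.
apply: leq_trans u_n; rewrite -(perm_size (permEl (perm_filterC (fun z => z <= last x r) u))).
rewrite size_cat u_r /= addSn ltnS; apply: leq_trans (leq_addl _ _).
by rewrite (eq_filter (a2 := predC (fun z => z <= last x r))) // => z /=; rewrite ltNge.
Qed.
End Novelli.

Local Open Scope group_scope.

(** * Evaluation of words in monoids, and identities of the generated variety *)

Section FreeMonoid.
Context {X : choiceType}.
Implicit Types (M N : monoidType) (u v : word X).

Section Extension.
Context {M : monoidType}.
Variable f : X -> M.

Definition free_ext u : M := foldr (fun x m => f x * m) 1 u.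

Lemma free_extM : {morph free_ext : u v / u * v >-> u * v}.
Proof. by elim=> [|x u IH] v /=; rewrite ?mul1g // -mulgA -IH. Qed.

HB.instance Definition _ := isMultiplicative.Build (word X) M free_ext free_extM.
HB.instance Definition _ :=
  Multiplicative_isUMagmaMorphism.Build (word X) M free_ext erefl.
End Extension.

Lemma free_ext_uniq M (psi : UMagmaMorphism.type (word X) M) u :
  psi u = free_ext (fun x => psi [:: x]) u.
Proof.
elim: u => [|x u IH]; first exact: gmulf1.
by rewrite -[x :: u]/(([:: x] : word X) * u) gmulfM IH.
Qed.

Lemma free_ext_flatten (Y : choiceType) (f : X -> word Y) u :
  free_ext f u = flatten (map f u).
Proof. by elim: u => //= x u ->. Qed.

Lemma free_ext_comp M N (g : UMagmaMorphism.type M N) (f : X -> M) u :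
  g (free_ext f u) = free_ext (g \o f) u.
Proof. by elim: u => [|x u IH] /=; rewrite ?gmulf1 // gmulfM IH. Qed.

Lemma satisfiesP M (e : identity X) :
  satisfies M e <-> forall f : X -> M, free_ext f e.1 = free_ext f e.2.
Proof.
split=> [Me f|Me psi]; first exact: (Me (free_ext f)).
by rewrite !(free_ext_uniq psi).
Qed.

(** A valuation in a homomorphic image lifts along the surjection by choice, one in a submonoid is
    composed with the inclusion, and one in a product is treated by coordinates. *)
Lemma variety_satisfies (e : identity X) : variety (fun M => satisfies M e).
Proof.
split=> [M N g g_onto /satisfiesP Me|M P N /satisfiesP Me|I M Me]; apply/satisfiesP => f.
- have [h hE] := choice (fun x => g_onto (f x)).
  have -> : f = g \o h by apply: funext => x; rewrite /= hE.
  by rewrite -!free_ext_comp Me.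
- apply: val_inj; rewrite !free_ext_comp; exact: Me.
- apply: functional_extensionality_dep => i.
  have proj u : free_ext f u i = free_ext (fun x => f x i) u.
    by elim: u => //= x u <-.
  by rewrite !proj; move/satisfiesP: (Me i); apply.
Qed.

Lemma pi_free_ext (f : X -> word letter) u :
  free_ext (fun x => \pi_hypo%qT (f x)) u = \pi_hypo%qT (flatten (map f u)) :> hypo.
Proof. by elim: u => //= x u ->; rewrite pi_hypo_mul. Qed.

Lemma satisfies_hypoP (e : identity X) :
  satisfies hypo e <-> forall f : X -> word letter,
    hypo_eq (flatten (map f e.1)) (flatten (map f e.2)).
Proof.
split=> [/satisfiesP he f|he]; last apply/satisfiesP => f.
  by have := he (fun x => \pi_hypo%qT (f x)); rewrite !pi_free_ext => /eqmodP.
have -> : f = (fun x => \pi_hypo%qT (repr (f x))) by apply: funext => x; rewrite reprK.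
by rewrite !pi_free_ext; apply/eqmodP/he.
Qed.

(** The monoids satisfying an identity form a variety, so checking [hypo] is enough. *)
Lemma theory_same_pairs u v : same_pairs u v -> equational_theory V_hypo ((u, v) : identity X).
Proof.
move=> uv M VM; apply: (VM (fun M => satisfies M (u, v))); first exact: variety_satisfies.
by apply/satisfies_hypoP => f; apply/hypo_eq_same_pairs/same_pairs_flatten_map.
Qed.
End FreeMonoid.

(** * Connecting words by swaps of adjacent letters *)

Section Swaps.
Context {X : choiceType}.
Implicit Types (x y : X) (p q r u v w : word X).

(** Being an instance of [pairwise], this is invariant under [same_pairs]. *)
Definition avoids x y u := pairwise (fun a b => ~~ ((a == x) && (b == y))) u.

Arguments avoids : simpl never.

Lemma avoids_cons x y a u :
  avoids x y (a :: u) = ~~ ((a == x) && (y \in u)) && avoids x y u.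
Proof.
rewrite /avoids /=; congr andb; case: (a == x) => /=; last by apply/allP.
by rewrite -has_pred1 -all_predC.
Qed.

Lemma avoids_cat x y u v :
  avoids x y (u ++ v) = [&& ~~ ((x \in u) && (y \in v)), avoids x y u & avoids x y v].
Proof.
elim: u => //= a u IH; rewrite !avoids_cons IH inE mem_cat [x == a]eq_sym.
by do !case: (_ \in _); case: (a == x); case: (avoids x y u); case: (avoids x y v).
Qed.

Lemma avoids_notin x y u : (x \notin u) || (y \notin u) -> avoids x y u.
Proof.
elim: u => //= a u IH; rewrite avoids_cons !inE !negb_or [x == a]eq_sym => xy.
rewrite IH ?andbT; first by move: xy; case: (a == x); case: (y \in u); rewrite ?andbF.
by move: xy; do 2!case: (_ \in u); rewrite ?andbF.
Qed.

(* The substitutions are x -> 1 for the content, and x -> 2, y -> 1 for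
   [avoids x y], all other variables being erased. *)
Lemma satisfies_hypo_avoids u v : satisfies hypo ((u, v) : identity X) ->
  perm_eq u v /\ forall x y, x != y -> avoids x y u = avoids x y v.
Proof.
move=> /satisfies_hypoP /= uv.
pose one : letter := Sub 1%N isT; pose two : letter := Sub 2%N isT.
have two_one : (two <= one)%O = false by rewrite leEsub.
split=> [|x y xy].
  apply/allP => x _ /=; have := uv (fun y => if y == x then [:: one] else [::]).
  have fE w : flatten [seq if y == x then [:: one] else [::] | y <- w]
      = nseq (count_mem x w) one by elim: w => //= y w ->; case: (y == x).
  rewrite !fE => /hypo_eq_sorted vu; apply/eqP.
  have /vu/(congr1 size) : sorted <=%O (nseq (count_mem x u) one).
    by case: (count_mem x u) => //= n; elim: n => //= n ->; rewrite lexx.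
  by rewrite !size_nseq.
set f := fun z => if z == x then [:: two] else if z == y then [:: one] else [::].
have fE w : sorted <=%O (flatten (map f w)) = avoids x y w.
  rewrite (sorted_pairwise le_trans) pairwise_flatten pairwise_map.
  have -> : all (pairwise <=%O) (map f w).
    by apply/allP => _ /mapP[z _ ->]; rewrite /f; case: ifP => // _; case: ifP.
  apply: eq_pairwise => a b /=; rewrite /f.
  case: (eqVneq a x) => [_|_] /=.
    have [->|bx] := eqVneq b x; first by rewrite allrel1l /= (negPf xy).
    by case: (b == y); rewrite allrel1l //= two_one.
  case: (a == y); last by rewrite allrel0l.
  by case: (b == x); rewrite ?allrel1l //=; case: (b == y); rewrite ?allrel1l.
(* A sorted word is alone in its hypoplactic class, so either image is sorted only if the other
   is. *)
have uv_f := uv f; rewrite -!fE; apply/idP/idP => s_f.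
  by rewrite (hypo_eq_sorted uv_f).
by rewrite hypo_eq_sym in uv_f; rewrite (hypo_eq_sorted uv_f).
Qed.

Definition swap u v := exists x y p q,
  [/\ u = p ++ x :: y :: q, v = p ++ y :: x :: q,
      (x \in p) || (y \in q) & (y \in p) || (x \in q)].

(** The exchange creates a single new ordered pair, [y] before [x], and the hypothesis provides this
    pair elsewhere in the first word. *)
Lemma pairwise_swap (r : rel X) p q x y : (y \in p) || (x \in q) ->
  pairwise r (p ++ x :: y :: q) -> pairwise r (p ++ y :: x :: q).
Proof.
move=> yx; rewrite !pairwise_cat /= => /and3P[/allrelP rp -> /and3P[/andP[_ xq] yq ->]].
rewrite xq yq !andbT /=; apply/andP; split.
  apply/allrelP => z t z_p; rewrite !inE orbCA => t_q.
  by apply: rp => //; rewrite !inE.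
case/orP: yx => [y_p|x_q]; last exact: (allP yq).
by apply: rp => //; rewrite mem_head.
Qed.

Lemma swap_same_pairs u v : swap u v -> same_pairs u v.
Proof.
move=> [x [y [p [q [-> -> xy yx]]]]]; split=> [|r].
  by rewrite perm_cat2l -(perm_catCA [:: y] [:: x] q).
by apply/idP/idP; apply: pairwise_swap.
Qed.

Lemma swaps_avoids x y u v :
  clos_refl_trans_1n _ swap u v -> avoids x y u = avoids x y v.
Proof. by elim=> // u' v' w /swap_same_pairs[_ uv'] _ <-; exact: uv'. Qed.

Lemma swaps_trans u v w : clos_refl_trans_1n _ swap u v ->
  clos_refl_trans_1n _ swap v w -> clos_refl_trans_1n _ swap u w.
Proof.
move=> uv vw; apply: clos_rt_rt1n.
by apply: (@rt_trans _ _ _ v); apply: clos_rt1n_rt.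
Qed.

(** The letter [a] passes the letters of [p] from right to left. The hypothesis on [r] and [q]
    justifies every swap, since the letters already passed only enlarge the suffix. *)
Lemma swaps_to_front r p a q :
  {in p, forall y, ((y \in r) || (a \in q)) && ((a \in r) || (y \in q))} ->
  clos_refl_trans_1n _ swap (r ++ p ++ a :: q) (r ++ a :: p ++ q).
Proof.
elim/last_ind: p q => [|p y IH] q pP; first exact: rt1n_refl.
have := pP y; rewrite mem_rcons mem_head => /(_ isT)/andP[yr ar].
have step : swap (r ++ rcons p y ++ a :: q) (r ++ p ++ a :: y :: q).
  exists y, a, (r ++ p), q; split; rewrite ?mem_cat ?cat_rcons ?catA //.
    by rewrite orbAC yr.
  by rewrite orbAC ar.
apply: (Relation_Operators.rt1n_trans _ _ _ _ _ step); rewrite cat_rcons; apply: IH => z z_p.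
have := pP z; rewrite mem_rcons inE z_p orbT => /(_ isT).
rewrite !inE => /andP[/orP[->|->] /orP[->|->]]; rewrite ?orbT //.
Qed.

(** The induction moves letters into [r], the common prefix already matched. The first occurrence in
    [u] of the next letter [a] is the one carried forward, so [a] is not among the letters it
    passes. *)
Lemma swaps_connect r u v : perm_eq u v ->
  (forall x y, x != y -> avoids x y (r ++ u) = avoids x y (r ++ v)) ->
  clos_refl_trans_1n _ swap (r ++ u) (r ++ v).
Proof.
elim: v r u => [|a v IH] r u uv ruv.
  by move/perm_nilP: uv => ->; exact: rt1n_refl.
have : a \in u by rewrite (perm_mem uv) mem_head.
have splitu w : a \in w -> exists p q, w = p ++ a :: q /\ a \notin p.
  elim: w => //= b w IHw; rewrite inE; have [->|ab /= /IHw] := eqVneq a b.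
    by move=> _; exists [::], w.
  by case=> p [q [-> a_p]]; exists (b :: p), q; rewrite inE negb_or ab.
move=> /splitu[p [q [u_pq a_p]]]; rewrite {}u_pq {u} in uv ruv *.
have pq_v : perm_eq (p ++ q) v by rewrite -(perm_cons a) -(perm_catCA p [:: a] q).
have front : clos_refl_trans_1n _ swap (r ++ p ++ a :: q) (r ++ a :: p ++ q).
  apply: swaps_to_front => y y_p.
  have ya : y != a by apply: contraNneq a_p => <-.
  have y_v : y \in v by rewrite -(perm_mem pq_v) mem_cat y_p.
  apply/andP; split.
    (* Since [y] precedes [a] in [p ++ a :: q], the pair also occurs in [r ++ a :: v]; so [y] is in
       [r] or [a] recurs in [v], hence in [q]. *)
    have := ruv y a ya; rewrite !avoids_cat y_p mem_head /= !andbF => /esym/negbT.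
    apply: contraNT; rewrite negb_or => /andP[y_r a_q].
    have a_v : a \notin v by rewrite -(perm_mem pq_v) mem_cat negb_or a_p.
    by rewrite (negPf y_r) avoids_cons eq_sym (negPf ya) !avoids_notin ?y_r ?a_v ?orbT.
  (* Conversely, [a] precedes [y] in [a :: v], hence also in [r ++ p ++ a :: q], where this needs
     [a] in [r] or [y] in [q]. *)
  have := ruv a y; rewrite eq_sym ya => /(_ isT).
  rewrite !avoids_cat !avoids_cons eqxx y_v !andbF => /negbT.
  apply: contraNT; rewrite negb_or => /andP[a_r y_q].
  by rewrite (negPf a_r) (negPf a_p) (negPf y_q) !avoids_notin ?a_r ?a_p ?y_q ?orbT.
apply: (swaps_trans front); rewrite -!cat_rcons; apply: IH => // x y xy.
by rewrite !cat_rcons -(swaps_avoids x y front) ruv.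
Qed.
End Swaps.

(** * The identities of rank at most 4 form a basis *)

Section Basis.
Context {X : choiceType} (infX : infinite_set [set: X]%classic).
Implicit Types (u v w p q : word X).

Definition rank4_identities : set (identity X) :=
  [set e | equational_theory V_hypo e /\ (rank e <= 4)%N]%classic.

Lemma distinct_variables n : exists2 s : seq X, uniq s & size s = n.
Proof.
have [B _ nB] := infinite_set_fset n infX.
by exists (take n B); rewrite ?take_uniq ?fset_uniq // size_takel.
Qed.

(* The natural numbers 0, ..., 3 stand for distinct variables of X, which the
   substitution sends to the entries of S. *)
Lemma deduction_step_instance (l m : seq nat) (S : seq (word X)) p q :
  swap l m -> all (fun i => (i < 4)%N) l ->
  deduction_step rank4_identities
    (p ++ flatten (map (nth [::] S) l) ++ q) (p ++ flatten (map (nth [::] S) m) ++ q).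
Proof.
move=> /swap_same_pairs lm l4; have m4 : all (fun i => (i < 4)%N) m by rewrite -(perm_all _ lm.1).
have [s s_uniq s4] := distinct_variables 4.
have x0 : X by case: (s) s4 => [|x _ _].
pose f := nth x0 s.
pose sigma : UMagmaMorphism.type (word X) (word X) :=
  free_ext (fun x => nth [::] S (index x s) : word X).
have sigmaE k : all (fun i => (i < 4)%N) k ->
    sigma (map f k) = flatten (map (nth [::] S) k).
  move=> /allP k4; rewrite /sigma /= free_ext_flatten -map_comp; congr flatten.
  by apply/eq_in_map => i /k4 i4; rewrite /= index_uniq ?s4.
exists (map f l), (map f m), p, q, sigma; split; [left; split|by rewrite sigmaE // -mulgA..].
  apply: theory_same_pairs; case: lm => lm rlm; split=> [|r];
    by rewrite ?perm_map // !pairwise_map.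
rewrite /rank /= -map_cat -s4; apply: uniq_leq_size; first exact: undup_uniq.
move=> _ /[!mem_undup] /mapP[i i_lm ->]; apply: mem_nth; rewrite s4.
by move: i_lm; rewrite mem_cat => /orP[/(allP l4)|/(allP m4)].
Qed.

Lemma swap_deduction_step u v : swap u v -> deduction_step rank4_identities u v.
Proof.
move=> [x [y [p [q [-> -> xp yp]]]]].
have [xy|xy] := eqVneq x y.
  (* For equal letters the two words coincide, and the identity between empty words justifies the
     step. *)
  exists [::], [::], (p ++ x :: y :: q), [::], (free_ext (fun z => [:: z] : word X)).
  split; [|by rewrite xy /= !mulg1..].
  by left; split=> //; apply: theory_same_pairs.
have two_letters (s : word X) : x \in s -> y \in s -> exists a b s1 s2 s3,
    s = s1 ++ a :: s2 ++ b :: s3 /\ ((a, b) = (x, y) \/ (a, b) = (y, x)).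
  move=> /splitPr[s1 s2]; rewrite mem_cat inE eq_sym (negPf xy) /=.
  case/orP=> /splitPr[s3 s4]; first by exists y, x, s3, s4, s2; rewrite -catA; auto.
  by exists x, y, s1, s3, s4; auto.
(* The codes 0 and 1 stand for [x] and [y], and 2 and 3 for the factors separating the relevant
   occurrences; the outermost factors become the context. Six identities arise, since two witnesses
   on the same side may come in either order. *)
have inst l m s2 s3 := @deduction_step_instance l m [:: [:: x]; [:: y]; s2; s3].
case/orP: xp => [x_p|y_q]; case/orP: yp => [y_p|x_q].
- have [a [b [p1 [p2 [p3 [-> [] [-> ->]]]]]]] := two_letters p x_p y_p.
    have := inst [:: 0; 2; 1; 3; 0; 1]%N [:: 0; 2; 1; 3; 1; 0]%N p2 p3 p1 q.
    rewrite /= -?catA /= -?catA; apply=> //.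
    by exists 0%N, 1%N, [:: 0; 2; 1; 3]%N, [::].
  have := inst [:: 1; 2; 0; 3; 0; 1]%N [:: 1; 2; 0; 3; 1; 0]%N p2 p3 p1 q.
  rewrite /= -?catA /= -?catA; apply=> //.
  by exists 0%N, 1%N, [:: 1; 2; 0; 3]%N, [::].
- case/splitPr: x_p => p1 p2; case/splitPr: x_q => q1 q2.
  have := inst [:: 0; 2; 0; 1; 3; 0]%N [:: 0; 2; 1; 0; 3; 0]%N p2 q1 p1 q2.
  rewrite /= -?catA /= -?catA; apply=> //.
  by exists 0%N, 1%N, [:: 0; 2]%N, [:: 3; 0]%N.
- case/splitPr: y_p => p1 p2; case/splitPr: y_q => q1 q2.
  have := inst [:: 1; 2; 0; 1; 3; 1]%N [:: 1; 2; 1; 0; 3; 1]%N p2 q1 p1 q2.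
  rewrite /= -?catA /= -?catA; apply=> //.
  by exists 0%N, 1%N, [:: 1; 2]%N, [:: 3; 1]%N.
have [a [b [q1 [q2 [q3 [-> [] [-> ->]]]]]]] := two_letters q x_q y_q.
  have := inst [:: 0; 1; 2; 0; 3; 1]%N [:: 1; 0; 2; 0; 3; 1]%N q1 q2 p q3.
  rewrite /= -?catA /= -?catA; apply=> //.
  by exists 0%N, 1%N, [::], [:: 2; 0; 3; 1]%N.
have := inst [:: 0; 1; 2; 1; 3; 0]%N [:: 1; 0; 2; 1; 3; 0]%N q1 q2 p q3.
rewrite /= -?catA /= -?catA; apply=> //.
by exists 0%N, 1%N, [::], [:: 2; 1; 3; 0]%N.
Qed.

Lemma rank4_basis : basis V_hypo rank4_identities.
Proof.
apply/seteqP; split=> -[u v] uv.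
  (* Completeness: [hypo] belongs to the variety that it generates. *)
  have [uv_p uv_a] := satisfies_hypo_avoids (uv hypo (fun V _ => id)).
  have uv_swap : clos_refl_trans_1n _ swap u v by exact: (swaps_connect (r := [::])).
  rewrite /consequences /=; elim: uv_swap => [w|w1 w2 w3 /swap_deduction_step w12 _].
    exact: rt1n_refl.
  exact: Relation_Operators.rt1n_trans.
(* Soundness: composing [psi] with the substitution of a deduction step gives a valuation in [M]
   again. *)
move=> M VM psi /=.
have : clos_refl_trans_1n _ (deduction_step rank4_identities) u v by exact: uv.
elim=> {u v uv} // w w' w'' [l [m [r [s [sigma [lm -> ->]]]]]] _ <-.
rewrite !gmulfM; congr (_ * _ * _).
have lmM e : rank4_identities e -> psi (sigma e.1) = psi (sigma e.2).
  move=> [eV _]; rewrite (free_ext_uniq sigma) (free_ext_uniq sigma e.2) !free_ext_comp.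
  by have /satisfiesP := eV M VM; apply.
by case: lm => /lmM.
Qed.
End Basis.

Theorem corollary4p9 (X : choiceType) (infX : infinite_set [set: X]%classic) :
  finite_axiomatic_rank X V_hypo.
Proof.
(* Rank 4 is only an upper bound; the least rank comes from the well-ordering of the natural
   numbers, applied to the property made boolean. *)
have ex_rank : exists r, `[< has_basis_of_rank_le X V_hypo r >].
  exists 4%N; apply/asboolP; exists rank4_identities; first exact: rank4_basis.
  by move=> e [].
exists (ex_minn ex_rank); case: ex_minnP => r /asboolP r_basis r_min.
by split=> // r' /asboolP/r_min.
Qed.
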